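(* Let $\mu_{0s},\hat\mu_{0s},\mu_{1s}$ be probability measures on $\mathbb{R}^d$ such that $\mu_{1s}\ll\mu_{0s}$, with $\phi=d\mu_{1s}/d\mu_{0s}$ nowhere constant, and let $\chi_s(\mathbf{z})=\mu_{0s}(\{\mathbf{x}:\phi(\mathbf{x})>\phi(\mathbf{z})\})$ for $\mathbf{z}\in\mathbb{R}^d$. Let $\hat{\mathbf{X}}_s\sim\hat\mu_{0s}$, $\hat Y_s=\chi_s(\hat{\mathbf{X}}_s)$, and let $\hat F_s$ be the cumulative distribution function of $\hat Y_s$. Let $\epsilon\ge0$. If $|\mu_{0s}(A)-\hat\mu_{0s}(A)|\le\epsilon\,\mu_{0s}(A)$ for every measurable set $A$, then $$|\hat F_s(y_s)-y_s|\le\epsilon\,y_s\qquad\text{for all } y_s\in[0,1].$$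
   Context: ''$\phi$ is nowhere constant'' means $\mu_{0s}\{\mathbf{x}:\phi(\mathbf{x})=c\}=0$ for every $c$. *)

(* Defs.v *)
From HB Require Import structures.
From mathcomp Require Import all_boot all_order all_algebra.
From mathcomp Require Import all_classical all_reals all_analysis.
From mathcomp Require Import measurable_realfun.

Set Implicit Arguments.
Unset Strict Implicit.
Unset Printing Implicit Defensive.
Import Order.TTheory GRing.Theory Num.Theory numFieldNormedType.Exports.

Local Open Scope classical_set_scope.
Local Open Scope ring_scope.

(* R^n with its Borel sigma-algebra, generated by the open sets of the usual
   topology on row vectors *)
Notation borel_rV R n := (g_sigma_algebraType (@open 'rV[R]_n)).

(* phi is a version of the density d nu / d mu; the library's 'd nu '/d mu is
   one arbitrarily chosen version, with values in \bar R *)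
Definition density d (T : measurableType d) (R : realType)
    (nu mu : probability T R) (phi : T -> R) : Prop :=
  ae_eq mu [set: T] (EFin \o phi)
    (Radon_Nikodym (charge_of_finite_measure nu) mu).

Definition nowhere_constant d (T : measurableType d) (R : realType)
    (mu : probability T R) (phi : T -> R) : Prop :=
  forall c : R, mu [set x | phi x = c] = 0%E.

Section chi.
Context d (T : measurableType d) (R : realType).
Variables (mu : probability T R) (phi : {mfun T >-> R}).

Definition chi (z : T) : R := fine (mu [set x | phi z < phi x]).

Let measurable_chi : measurable_fun [set: T] chi.
Proof.
pose g (t : R) := fine (mu (phi @^-1` `]t, +oo[)).
have mphi B : measurable B -> measurable (phi @^-1` B).
  by move=> mB; rewrite -[X in measurable X]setTI; exact: measurable_funP.
have gE : chi = g \o phi.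
  apply/funext => z; rewrite /chi /g /=; congr (fine (mu _)).
  by apply/seteqP; split => x /=; rewrite in_itv /= andbT.
rewrite gE; apply: measurableT_comp => //.
apply: nonincreasing_measurable => // s t st.
rewrite /g fine_le ?fin_num_measure//; try exact: mphi.
apply: le_measure; rewrite ?inE; try exact: mphi.
by move=> x /=; rewrite !in_itv /= !andbT; exact: le_lt_trans.
Qed.

HB.instance Definition _ := isMeasurableFun.Build _ _ _ _ chi measurable_chi.

End chi.

(* Main.v *)
(* Under mu0 the variable chi is uniform on [0, 1]: as phi has no atoms, its cdf
   is continuous, so every y in ]0, 1[ is the mass of some superlevel set
   {phi > t}.  The event {chi <= y} contains the superlevel set of mass y and is
   contained in those of mass y + e, hence has mu0-mass y, and the closeness
   hypothesis applied to this single event is the claim. *)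
Require Import Defs.
From HB Require Import structures.
From mathcomp Require Import all_boot all_order all_algebra.
From mathcomp Require Import all_classical all_reals all_analysis.
From mathcomp Require Import lra.
Import Order.TTheory GRing.Theory Num.Theory numFieldNormedType.Exports.

Local Open Scope classical_set_scope.
Local Open Scope ring_scope.

Section atomless.
Context d (T : measurableType d) (R : realType) (mu : probability T R).
Variable phi : {mfun T >-> R}.

Lemma measurable_chi_sublevel (y : R) : measurable [set z | chi mu phi z <= y].
Proof.
rewrite (_ : [set _ | _] = chi mu phi @^-1` `]-oo, y]).
  exact: measurable_funPTI.
by apply/seteqP; split => x /=; rewrite in_itv.
Qed.

Lemma measurable_superlevel t : measurable [set x | t < phi x].
Proof.
rewrite (_ : [set _ | _] = phi @^-1` `]t, +oo[); first exact: measurable_funPTI.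
by apply/seteqP; split => x /=; rewrite in_itv /= andbT.
Qed.

Lemma superlevelE t : mu [set x | t < phi x] = ccdf (phi : {RV mu >-> R}) t.
Proof.
rewrite /ccdf /distribution /pushforward; congr (mu _).
by apply/seteqP; split => x /=; rewrite in_itv /= andbT.
Qed.

Hypothesis phi_nc : nowhere_constant mu phi.

(* Since phi has no atoms, cdf phi (- s) is the complementary cdf of - phi at s,
   so left continuity follows from the right continuity of every cdf. *)
Lemma cdf_continuous : continuous (cdf (phi : {RV mu >-> R})).
Proof.
move=> t; apply/left_right_continuousP; split; last exact: cdf_right_continuous.
apply/cvg_at_leftNP.
have mN : measurable_fun [set: T] (-%R \o phi) by exact: measurableT_comp.
pose Nphi : {RV mu >-> R} :=
  HB.pack (-%R \o phi) (isMeasurableFun.Build _ _ _ _ _ mN).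
have cdfN s : cdf (phi : {RV mu >-> R}) (- s) = (1 - cdf Nphi s)%E.
  have -> : cdf (phi : {RV mu >-> R}) (- s) = ccdf Nphi s.
    rewrite /cdf /ccdf /distribution /pushforward /=.
    (* The two events differ by the level set of [phi] at [- s], which is null because [phi] is
       nowhere constant. *)
    have lE : phi @^-1` `]-oo, (- s)] =
        Nphi @^-1` `]s, +oo[ `|` [set x | phi x = - s].
      apply/seteqP; split => x /=; rewrite !in_itv /= andbT ltrNr.
        by rewrite le_eqVlt => /predU1P[]; [right|left].
      by case=> [/ltW //|->].
    rewrite lE measureU0//; last exact: phi_nc.
      exact: measurable_funPTI.
    rewrite (_ : [set x | _] = phi @^-1` [set - s])//; exact: measurable_funPTI.
  by rewrite -(cdf_ccdf_1 Nphi s) addeAC subee ?add0e// fin_num_measure.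
rewrite (_ : _ \o _ = fun s => (1 - cdf Nphi s)%E); last exact/funext/cdfN.
rewrite -[in X in _ --> X](opprK t) cdfN.
apply: cvgeB => //; first exact: cvg_cst.
exact: cdf_right_continuous.
Qed.

(** The endpoints are excluded because [phi] may be unbounded: the masses 0 and 1 are then possibly
    only limits. *)
Lemma superlevel_mass_attained (y : R) : 0 < y < 1 ->
  exists t, mu [set x | t < phi x] = y%:E.
Proof.
move=> /andP[y0 y1].
pose F := cdf (phi : {RV mu >-> R}).
have Ffin s : F s \is a fin_num by rewrite fin_num_measure.
have Fcont : continuous (fine \o F).
  by move=> s; apply: fine_cvg; rewrite fineK//; exact: cdf_continuous.
have [a Fa] : exists a, (fine (F a) < 1 - y).
  have /fine_cvg cvF := cvg_cdfNy0 (phi : {RV mu >-> R}).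
  have y1' : 0 < 1 - y by rewrite subr_gt0.
  exact: (filter_ex (cvgr_lt _ cvF _ y1')).
have [b Fb] : exists b, (1 - y < fine (F b)).
  have /fine_cvg cvF := cvg_cdfy1 (phi : {RV mu >-> R}).
  have y1' : 1 - y < 1 by rewrite gtrBl.
  exact: (filter_ex (cvgr_gt _ cvF _ y1')).
(* The cdf is the mass of the complement of a superlevel set, hence the level [1 - y]. *)
have [c _ Fc] : exists2 c, c \in `[a, b] & fine (F c) = 1 - y.
  apply: IVT.
  - rewrite leNgt; apply/negP => /ltW ba.
    have := cdf_nondecreasing (phi : {RV mu >-> R}) ba.
    rewrite -/F -(fineK (Ffin a)) -(fineK (Ffin b)) lee_fin; lra.
  - exact: continuous_subspaceT.
  - by rewrite ge_min le_max (ltW Fa) (ltW Fb) orbT.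
exists c; rewrite superlevelE.
have := cdf_ccdf_1 (phi : {RV mu >-> R}) c; rewrite -/F -(fineK (Ffin c)) Fc.
rewrite -[X in (_ + X)%E]fineK ?fin_num_measure// -EFinD => -[Gc].
rewrite -[LHS]fineK ?fin_num_measure//; congr EFin; lra.
Qed.

Lemma chi_sublevel_mass (y : R) : 0 <= y <= 1 ->
  mu [set z | chi mu phi z <= y] = y%:E.
Proof.
move=> /andP[y0 y1].
have muK t : (fine (mu [set x | t < phi x]))%:E = mu [set x | t < phi x].
  by rewrite fineK// fin_num_measure//; exact: measurable_superlevel.
have mA := measurable_chi_sublevel y.
have le_superlevel s t : s <= t ->
    (mu [set x | (t < phi x)%R] <= mu [set x | (s < phi x)%R])%E.
  move=> st; apply: le_measure; rewrite ?inE; try exact: measurable_superlevel.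
  by move=> x /=; exact: le_lt_trans.
(* At [y = 1] no superlevel set is needed: [chi] never exceeds 1, so the event is the whole
   space. *)
move: y1; rewrite le_eqVlt => /predU1P[->|y1].
  rewrite -(@probability_setT _ _ _ mu); congr (mu _).
  apply/seteqP; split => // z _ /=.
  by rewrite -lee_fin /chi muK probability_le1//; exact: measurable_superlevel.
apply/eqP; rewrite eq_le; apply/andP; split.
  (* The slack makes the inclusion work: outside the superlevel set of mass [y + e] one only has
     [chi z >= y + e], which contradicts [chi z <= y] because [e > 0]. If [y + e >= 1], the bound is
     trivial. *)
  apply/lee_addgt0Pr => e e0.
  have [ye1|ye1] := ltP (y + e) 1; last first.
    by rewrite (le_trans (probability_le1 _ _))// -EFinD lee_fin.
  have [|t tE] := @superlevel_mass_attained (y + e); first by lra.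
  rewrite -EFinD -tE; apply: le_measure; rewrite ?inE//.
    exact: measurable_superlevel.
  move=> z /=; apply: contraTT; rewrite -leNgt -ltNge -lte_fin /chi muK => zt.
  by rewrite (lt_le_trans _ (le_superlevel _ _ zt))// tE lte_fin ltrDl.
move: y0; rewrite [0 <= _]le_eqVlt => /predU1P[<-|y0]; first exact: measure_ge0.
have [|t tE] := @superlevel_mass_attained y; first by rewrite y0.
rewrite -tE; apply: le_measure; rewrite ?inE//.
  exact: measurable_superlevel.
(* If [phi z > t], then the superlevel set at [phi z] lies in the one at [t], whose mass is [y]. *)
by move=> z /= tz; rewrite -lee_fin /chi muK -tE le_superlevel// ltW.
Qed.

End atomless.

Theorem theorem6p1 (R : realType) (n : nat)
    (mu0 muh0 mu1 : probability (borel_rV R n) R)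
    (mu1_ac : mu1 `<< mu0)
    (phi : {mfun borel_rV R n >-> R})
    (phi_density : density mu1 mu0 phi)
    (phi_nc : nowhere_constant mu0 phi)
    (d : measure_display) (Omega : measurableType d) (P : probability Omega R)
    (X : {RV P >-> borel_rV R n})
    (X_law : forall A : set (borel_rV R n), measurable A ->
       distribution P X A = muh0 A)
    (eps : R) (eps_ge0 : 0 <= eps)
    (close : forall A : set (borel_rV R n), measurable A ->
       (`|mu0 A - muh0 A| <= eps%:E * mu0 A)%E)
    (y : R) (y01 : 0 <= y <= 1) :
  (`|cdf (chi mu0 phi \o X : {RV P >-> R}) y - y%:E| <= eps%:E * y%:E)%E.
Proof.
have mA := measurable_chi_sublevel _ _ _ mu0 phi y.
(* The preimage of []-oo, y]] under [chi \o X] is the preimage under [X] of the event [chi <= y], so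
   the law of [X] applies. *)
have -> : cdf (chi mu0 phi \o X : {RV P >-> R}) y =
    muh0 [set z | chi mu0 phi z <= y].
  by rewrite -X_law.
(* Since the event has [mu0]-mass exactly [y], closeness gives the claim up to the order of the
   difference. *)
have := close _ mA; rewrite chi_sublevel_mass//.
rewrite -[muh0 _]fineK ?fin_num_measure//.
by rewrite -!EFinB !abse_EFin distrC.
Qed.
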